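(* Let $A_1A_2A_3A_4$ be an arbitrary tetrahedron of volume $1$. Choose a point $P_1$ on the edge $A_1A_2$, a point $P_2$ on the edge $A_2A_3$, a point $P_3$ on the edge $A_3A_4$, and a point $P_4$ on the edge $A_4A_1$ such that $$\frac{|P_1A_1|}{|P_1A_2|}=x_1,\quad \frac{|P_2A_2|}{|P_2A_3|}=x_2,\quad \frac{|P_3A_3|}{|P_3A_4|}=x_3,\quad \frac{|P_4A_4|}{|P_4A_1|}=x_4,$$ where $x_1,x_2,x_3,x_4$ are positive real numbers. Then the volume of the tetrahedron $P_1P_2P_3P_4$ is $$V_{P_1P_2P_3P_4}=\frac{|1-x_1x_2x_3x_4|}{(1+x_1)(1+x_2)(1+x_3)(1+x_4)}.$$ Moreover, the four planes through the points $A_1,A_2,P_3$, through $A_2,A_3,P_4$, through $A_3,A_4,P_1$, and through $A_4,A_1,P_2$ enclose a tetrahedron $R_1R_2R_3R_4$ of volume $$V_{R_1R_2R_3R_4}=\frac{|1-x_1x_2x_3x_4|^3}{D_1D_2D_3D_4},$$ where $$D_1=1+x_1+x_1x_2+x_1x_2x_3,\qquad D_2=1+x_2+x_2x_3+x_2x_3x_4,$$ $$D_3=1+x_3+x_3x_4+x_3x_4x_1,\qquad D_4=1+x_4+x_4x_1+x_4x_1x_2.$$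
   Context: $|XY|$ is the length of the segment $XY$, and $V_{XYZW}$ is the (unsigned) volume of the possibly degenerate tetrahedron with vertices $X,Y,Z,W$ in three-dimensional Euclidean space. Each $P_i$ lies in the interior of the indicated edge. The tetrahedron $R_1R_2R_3R_4$ enclosed by the four planes is the one whose four vertices are the intersection points of the four triples of these planes (the four points coincide, and the volume is $0$, when $x_1x_2x_3x_4=1$). *)

(* Defs.v *)
From HB Require Import structures.
From mathcomp Require Import all_boot all_order all_algebra.
From mathcomp Require Import all_classical all_reals all_analysis.
Import numFieldNormedType.Exports.

Set Implicit Arguments.
Unset Strict Implicit.
Unset Printing Implicit Defensive.

Import Order.TTheory GRing.Theory Num.Theory.
Local Open Scope classical_set_scope.
Local Open Scope ring_scope.

(* The norm [`|_|] that MathComp-Analysis puts on ['rV[R]_3] is the sup norm,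
   hence an explicit Euclidean distance. *)
Definition eucl_dist (R : realType) (X Y : 'rV[R]_3) : R :=
  Num.sqrt (\sum_(i < 3) (X 0 i - Y 0 i) ^+ 2).

Definition open_edge (R : realType) (X Y : 'rV[R]_3) : set 'rV[R]_3 :=
  [set P | exists2 t : R, 0 < t < 1 & P = (1 - t) *: X + t *: Y].

(* A genuine plane whenever X, Y, Z are not collinear. *)
Definition plane (R : realType) (X Y Z : 'rV[R]_3) : set 'rV[R]_3 :=
  [set P | exists s t : R, P = X + s *: (Y - X) + t *: (Z - X)].

Definition tetrahedron (R : realType) (X Y Z W : 'rV[R]_3) : set 'rV[R]_3 :=
  [set P | exists a b c d : R,
    [/\ [/\ 0 <= a, 0 <= b, 0 <= c & 0 <= d], a + b + c + d = 1 &
        P = a *: X + b *: Y + c *: Z + d *: W]].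

Definition row3 (R : realType) (p : R * R * R) : 'rV[R]_3 :=
  \row_(i < 3) [:: p.1.1; p.1.2; p.2]`_i.

(* There is no Lebesgue measure on ['rV[R]_3] itself: the volume of a set is
   the threefold product Lebesgue measure of its set of coordinate triples. *)
Definition volume (R : realType) (S : set 'rV[R]_3) : \bar R :=
  ((@lebesgue_measure R \x @lebesgue_measure R) \x @lebesgue_measure R)%E
    (@row3 R @^-1` S).

(* Main.v *)
Require Import Defs.
From HB Require Import structures.
From mathcomp Require Import all_boot all_order all_algebra.
From mathcomp Require Import perm.
From mathcomp Require Import all_classical all_reals all_analysis.
From mathcomp Require Import measurable_realfun ring lra.
Import numFieldNormedType.Exports.
Import Order.TTheory GRing.Theory Num.Theory.
Local Open Scope classical_set_scope.
Local Open Scope ring_scope.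

(** The volume is an affine invariant up to a determinant, and this reduces both
formulas to barycentric coordinates with respect to A1, A2, A3, A4.

Lebesgue measure on triples is rescaled by |det M| under v |-> v M + b
([rescales_affine]): M factors as a permutation, a lower and an upper triangular
matrix, hence into permutations of coordinates and maps that replace a single
coordinate by an affine form.  The former preserve the product measure by
Tonelli, the latter rescale each one-dimensional section.  Every tetrahedron is
an affine image of the unit one, or lies in a plane, which is null; so its volume
is |det| of its edge vectors times the volume of the unit tetrahedron
([volume_tetrahedron]).  That last constant is never computed: the hypothesis
that A1A2A3A4 has volume 1 eliminates it.  Consequently the volume of a
tetrahedron whose vertices have given barycentric coordinates is the absolute
value of a determinant in these coordinates alone ([volume_bary]).

The points are P1 = (A1 + x1 A2) / (1 + x1) and cyclically, which gives the first
volume.  With barycentric coordinates a1, a2, a3, a4, the plane through A3, A4, P1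
is the locus a2 = x1 a1, and cyclically ([plane_bary]).  Hence three of the
planes meet where three of the successive ratios of coordinates are prescribed,
for instance at the multiple of (1, x1, x1 x2, x1 x2 x3) with sum 1, whose
normalization is 1 / D1 ([three_planes]).  The four vertices found in this way
form, up to row scaling, a matrix with determinant - (1 - x1 x2 x3 x4)^3. *)
Set Implicit Arguments.
Unset Strict Implicit.
Unset Printing Implicit Defensive.

(** * Three coordinates *)

(** Case analysis that yields the numerals 0, 1, 2, on which rewriting works,
instead of ordinals carrying proofs. *)
Lemma ord3_ind (P : 'I_3 -> Prop) : P 0 -> P 1 -> P 2%:R -> forall i, P i.
Proof.
move=> P0 P1 P2 [[|[|[|//]]] i3].
- by rewrite (_ : Ordinal i3 = 0) //; exact/val_inj.
- by rewrite (_ : Ordinal i3 = 1) //; exact/val_inj.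
- by rewrite (_ : Ordinal i3 = 2%:R) //; exact/val_inj.
Qed.

Lemma perm3_ind (P : 'S_3 -> Prop) :
  P 1%g -> (forall s t, P s -> P t -> P (s * t)%g) ->
  P (tperm 0 1) -> P (tperm 1 2%:R) -> forall s, P s.
Proof.
move=> P1 PM P01 P12 s.
have P02 : P (tperm 0 2%:R).
  pose t01 : 'S_3 := tperm 0 1; pose t12 : 'S_3 := tperm 1 2%:R.
  rewrite (_ : tperm 0 2%:R = (t01 * t12 * t01)%g).
    exact: PM (PM _ _ P01 P12) P01.
  by apply/permP; apply: ord3_ind; rewrite !permE /= !permE /= !permE.
have Ptperm : forall i j, P (tperm i j).
  by do 2!apply: ord3_ind; rewrite ?tperm1 // tpermC.
have [ts -> _] := prod_tpermP s.
by elim/big_ind: _ => // -[i j] _; exact: Ptperm.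
Qed.

Lemma sum_ord3 (V : nmodType) (F : 'I_3 -> V) :
  \sum_i F i = F 0 + F 1 + F 2%:R.
Proof.
rewrite !big_ord_recr big_ord0 /= add0r.
by congr (F _ + F _ + F _); exact/val_inj.
Qed.

Lemma det_mx33 (K : comNzRingType) (M : 'M[K]_3) :
  \det M = M 0 0 * (M 1 1 * M 2%:R 2%:R - M 1 2%:R * M 2%:R 1)
         - M 0 1 * (M 1 0 * M 2%:R 2%:R - M 1 2%:R * M 2%:R 0)
         + M 0 2%:R * (M 1 0 * M 2%:R 1 - M 1 1 * M 2%:R 0).
Proof.
have det2 (N : 'M[K]_2) : \det N = N 0 0 * N 1 1 - N 0 1 * N 1 0.
  rewrite (expand_det_row _ 0) !big_ord_recl big_ord0 addr0 /cofactor.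
  rewrite !det_mx11 !mxE /= expr0 expr1 mul1r mulN1r mulrN.
  by congr (_ * N _ _ - N _ _ * N _ _); exact/val_inj.
rewrite (expand_det_row _ 0) sum_ord3 /cofactor !det2 !mxE /=.
have l (i : 'I_3) (j : 'I_2) (k : 'I_3) : nat_of_ord (lift i j) = k -> lift i j = k.
  by move=> /val_inj.
rewrite (l 0 0 1) // (l 0 1 2%:R) // (l 1 0 0) // (l 1 1 2%:R) //.
rewrite (l 2%:R 0 0) // (l 2%:R 1 1) //.
rewrite (_ : (0 + 1 %% 3)%N = 1%N) // (_ : (0 + (1 %% 3 + 1 %% 3) %% 3)%N = 2%N) //.
by rewrite expr1 sqrrN expr1n; ring.
Qed.

(** Triangular factors are wanted because a vector can be multiplied by them in
place, one coordinate at a time: each step reads only coordinates that are still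
unmodified. *)
Lemma perm_LU (F : fieldType) n (A : 'M[F]_n.+1) :
  exists (s : 'S_n.+1) (L U : 'M[F]_n.+1),
  [/\ perm_mx s *m A = L *m U, \det L = 1,
      forall i j : 'I_n.+1, (i < j)%N -> L i j = 0 &
      forall i j : 'I_n.+1, (j < i)%N -> U i j = 0].
Proof.
have PA := cormen_lup_correct A.
have detL := cormen_lup_detL A; have L1 := @cormen_lup_lower _ _ A.
have U0 := @cormen_lup_upper _ _ A.
have /is_perm_mxP[s Ps] := cormen_lup_perm A.
case: (cormen_lup A) => [[P L] U] in PA detL L1 U0 Ps *.
exists s, L, U; split => //; first by rewrite !mulmxE -Ps.
by move=> i j ij; rewrite L1 ?(ltnW ij)// -val_eqE /= ltn_eqF.
Qed.

(** * Product measures *)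

Lemma lebesgue_measure_affine (R : realType) (c d : R) (B : set R) :
  c != 0 -> measurable B ->
  (lebesgue_measure [set z : R | B (c * z + d)%R] * `|c|%:E =
   lebesgue_measure B)%E.
Proof.
move=> c0 mB; rewrite muleC.
have mf : measurable_fun [set: measurableTypeR R]
    ((fun z => c * z + d) : _ -> measurableTypeR R).
  by apply: measurable_funD => //; exact: measurable_funM.
pose m := mscale (NngNum (normr_ge0 c)) (pushforward lebesgue_measure
  ((fun z => c * z + d) : measurableTypeR R -> measurableTypeR R)).
apply/esym; transitivity (m mf B); last by [].
apply: (lebesgue_measure_unique (mu := m mf)) => //= _ [[a b]] _ <-.
rewrite /m /mscale /= /pushforward lebesgue_measure_itv /= lte_fin.
have [c_gt0|c_lt0|/eqP] := ltrgt0P c; last by rewrite (negPf c0).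
- rewrite (_ : _ @^-1` _ = `]((a - d) / c), ((b - d) / c)]%classic).
    rewrite lebesgue_measure_itv/= lte_fin ltr_pM2r ?invr_gt0// ltrD2r.
    case: ifPn => _; last by rewrite mule0.
    by rewrite -!EFinB -EFinM; congr EFin; field.
  apply/seteqP; split => z /=; rewrite !in_itv/= ltr_pdivrMr// ler_pdivlMr//;
    by move=> /andP[? ?]; apply/andP; split; lra.
- rewrite (_ : _ @^-1` _ = `[((b - d) / c), ((a - d) / c)[%classic).
    rewrite lebesgue_measure_itv/= lte_fin ltr_nM2r ?invr_lt0// ltrD2r.
    case: ifPn => _; last by rewrite mule0.
    by rewrite -!EFinB -EFinM; congr EFin; field.
  apply/seteqP; split => z /=; rewrite !in_itv/= ltr_ndivlMr// ler_ndivrMr//;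
    by move=> /andP[? ?]; apply/andP; split; lra.
Qed.

(** Monotonicity on arbitrary sets, to be applied to a degenerate tetrahedron,
which is only shown to lie in a null set. *)
Lemma product_measure_le d1 d2 (T1 : measurableType d1)
    (T2 : measurableType d2) (R : realType) (m1 : {measure set T1 -> \bar R})
    (m2 : {measure set T2 -> \bar R}) (A B : set (T1 * T2)) :
  (forall x, m2 (xsection A x) <= m2 (xsection B x))%E ->
  ((m1 \x m2) A <= (m1 \x m2) B)%E.
Proof.
move=> AB; rewrite /product_measure1 !(ge0_integralTE m1) //.
(* the integral is a supremum over simple functions below the integrand *)
apply: le_ereal_sup => _ [h hA <-]; exists h => // x.
exact: le_trans (hA x) (AB x).
Qed.

Lemma product_measure_scale_xsection d1 d2 (T1 : measurableType d1)
    (T2 : measurableType d2) (R : realType) (m1 : {measure set T1 -> \bar R})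
    (m2 : {sigma_finite_measure set T2 -> \bar R}) (k : R)
    (A B : set (T1 * T2)) :
  0 <= k -> measurable A ->
  (forall x, m2 (xsection A x) * k%:E = m2 (xsection B x))%E ->
  ((m1 \x m2) A * k%:E = (m1 \x m2) B)%E.
Proof.
move=> k0 mA AB; rewrite /product_measure1.
rewrite -ge0_integralZr//; last exact: measurable_fun_xsection.
by apply: eq_integral => x _; exact: AB.
Qed.

Section triple_product.
Context d (T : measurableType d) (R : realType).
Variable m : {sigma_finite_measure set T -> \bar R}.
Local Open Scope ereal_scope.

Lemma product_measure_swap (A : set (T * T)) :
  measurable A -> (m \x m) [set p | A (p.2, p.1)] = (m \x m) A.
Proof.
move=> mA; transitivity ((m \x^ m)%E A).
  by apply: eq_integral => x _ /=; rewrite xsectionE ysectionE.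
apply/esym/product_measure_unique => //= B C mB mC; exact: product_measure2E.
Qed.

Lemma product_measure3_swap12 (S : set (T * T * T)) : measurable S ->
  (m \x m \x m) [set p | S (p.1.2, p.1.1, p.2)] = (m \x m \x m) S.
Proof.
move=> mS.
have mh := measurable_fun_xsection m mS.
have msw : measurable_fun setT swap_pair := @measurable_swap _ _ T T.
transitivity (\int[pushforward (m \x m) swap_pair]_p (m \o xsection S) p).
  by rewrite (ge0_integral_pushforward msw).
apply: (eq_measure_integral (m \x m)) => //= A mA _.
exact: product_measure_swap.
Qed.

(** The triple product associates to the left; this regroups it to the right, where
exchanging the last two coordinates is a swap inside the sections. *)
Lemma product_measure3_fubini (S : set (T * T * T)) : measurable S ->
  (m \x m \x m) S = \int[m]_x (m \x m) [set q | S (x, q.1, q.2)].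
Proof.
move=> mS; transitivity (\int[m \x m]_p (m \o xsection S) p) => //.
by rewrite fubini_tonelli1//; exact: measurable_fun_xsection.
Qed.

Lemma product_measure3_swap23 (S : set (T * T * T)) : measurable S ->
  (m \x m \x m) [set p | S (p.1.1, p.2, p.1.2)] = (m \x m \x m) S.
Proof.
move=> mS.
have mf : measurable_fun setT (fun p : T * T * T => (p.1.1, p.2, p.1.2)).
  apply: measurable_fun_pair; first apply: measurable_fun_pair => //;
    exact: measurableT_comp.
have mS' : measurable [set p | S (p.1.1, p.2, p.1.2)].
  by have := mf measurableT _ mS; rewrite setTI.
rewrite (product_measure3_fubini mS) (product_measure3_fubini mS').
apply: eq_integral => x _ /=.
rewrite -[RHS]product_measure_swap//.
have mx : measurable_fun setT (fun q : T * T => (x, q.1, q.2)).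
  by apply: measurable_fun_pair => //; apply: measurable_fun_pair.
by have := mx measurableT _ mS; rewrite setTI.
Qed.

End triple_product.

(** * Volume under affine maps *)

Section coordinates.
Variable R : realType.
Implicit Types (S : set 'rV[R]_3) (v : 'rV[R]_3).

Definition coords v : R * R * R := (v 0 0, v 0 1, v 0 2%:R).

Lemma row3K : cancel (@row3 R) coords.
Proof. by case=> -[x y] z; rewrite /coords !mxE. Qed.

Lemma coordsK : cancel coords (@row3 R).
Proof.
move=> v; apply/rowP => i; rewrite mxE.
by case: i => -[|[|[|//]]] i3 /=; congr (v _ _); exact/val_inj.
Qed.

Definition measurable3 S : Prop := measurable (@row3 R @^-1` S).

Lemma measurable3_preimage (f : 'rV[R]_3 -> 'rV[R]_3) S :
  (forall i, measurable_fun [set: R * R * R] (fun p => f (row3 p) 0 i)) ->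
  measurable3 S -> measurable3 (f @^-1` S).
Proof.
move=> mf mS.
have mg : measurable_fun [set: R * R * R] (coords \o f \o @row3 R).
  by do 2?apply: measurable_fun_pair; exact: mf.
have := mg measurableT _ mS; rewrite setTI.
by congr measurable; apply/seteqP; split => p /=; rewrite coordsK.
Qed.

Lemma measurable_row3_coord (i : 'I_3) :
  measurable_fun [set: R * R * R] (fun p => row3 p 0 i).
Proof.
under eq_fun do rewrite mxE.
case: i => -[|[|[|//]]] i3 /=.
- exact: measurableT_comp measurable_fst measurable_fst.
- exact: measurableT_comp measurable_snd measurable_fst.
- exact: measurable_snd.
Qed.

Lemma measurable_row3_linear (c : 'cV[R]_3) (d : R) :
  measurable_fun [set: R * R * R] (fun p => (row3 p *m c) 0 0 + d).
Proof.
apply: measurable_funD => //.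
under eq_fun do rewrite mxE.
apply: measurable_sum => i.
apply: measurable_funM => //.
exact: measurable_row3_coord.
Qed.

Lemma measurable3_xcol i j S : measurable3 S -> measurable3 (xcol i j @^-1` S).
Proof.
apply: measurable3_preimage => k; under eq_fun do rewrite mxE.
exact: measurable_row3_coord.
Qed.

Lemma volume_xcol01 S : measurable3 S -> volume (xcol 0 1 @^-1` S) = volume S.
Proof.
move=> mS; rewrite -[RHS](product_measure3_swap12 lebesgue_measure mS).
rewrite /volume; congr (_ _); apply/seteqP; split => -[[x y] z] /=;
  suff -> : xcol 0 1 (row3 (x, y, z)) = row3 (y, x, z) by [].
  by apply/rowP => -[[|[|[|//]]] i3]; rewrite !mxE permE.
by apply/rowP => -[[|[|[|//]]] i3]; rewrite !mxE permE.
Qed.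

Lemma volume_xcol12 S : measurable3 S ->
  volume (xcol 1 2%:R @^-1` S) = volume S.
Proof.
move=> mS; rewrite -[RHS](product_measure3_swap23 lebesgue_measure mS).
rewrite /volume; congr (_ _); apply/seteqP; split => -[[x y] z] /=;
  suff -> : xcol 1 2%:R (row3 (x, y, z)) = row3 (x, z, y) by [].
  by apply/rowP => -[[|[|[|//]]] i3]; rewrite !mxE permE.
by apply/rowP => -[[|[|[|//]]] i3]; rewrite !mxE permE.
Qed.

(** Stated for preimages, under which measurability is preserved; the factor k is
then that of direct images.  Measurability is included so that maps compose. *)
Definition rescales (f : 'rV[R]_3 -> 'rV[R]_3) (k : R) : Prop :=
  forall S, measurable3 S ->
    measurable3 (f @^-1` S) /\ (volume (f @^-1` S) * k%:E = volume S)%E.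

Lemma rescales_comp f g k l :
  rescales f k -> rescales g l -> rescales (g \o f) (k * l).
Proof.
move=> fk gl S mS; have [mgS gS] := gl S mS; have [mfgS fgS] := fk _ mgS.
by split => //; rewrite comp_preimage EFinM muleA fgS.
Qed.

Lemma rescales_col_perm (s : 'S_3) : rescales (col_perm s) 1.
Proof.
elim/perm3_ind: s => [|t u gt gu||].
- rewrite (_ : col_perm _ = id); last by apply/funext => v; rewrite col_perm1.
  by move=> S mS; rewrite preimage_id mule1.
- have := rescales_comp gu gt; rewrite mulr1.
  by congr rescales; apply/funext => v /=; rewrite col_permM.
- move=> S mS; split; first exact: measurable3_xcol.
  by rewrite mule1; exact: volume_xcol01.
- move=> S mS; split; first exact: measurable3_xcol.
  by rewrite mule1; exact: volume_xcol12.
Qed.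

(** The affine maps that change one coordinate; shears, dilations along an axis and
translations along an axis are all of this form. *)
Definition set_coord (j : 'I_3) (c : 'cV[R]_3) (d : R) (v : 'rV[R]_3) :=
  \row_i (if i == j then (v *m c) 0 0 + d else v 0 i).

(** Over fixed first two coordinates the map is z |-> c3 z + const on the section, so
the one-dimensional formula applies section by section. *)
Lemma rescales_set_coord_last (c : 'cV[R]_3) (d : R) :
  c 2%:R 0 != 0 -> rescales (set_coord 2%:R c d) `|c 2%:R 0|.
Proof.
move=> c0 S mS.
have mcS : measurable3 (set_coord 2%:R c d @^-1` S).
  apply: measurable3_preimage => // i; under eq_fun do rewrite mxE.
  by case: eqP => _; [exact: measurable_row3_linear|exact: measurable_row3_coord].
split => //.
apply: (product_measure_scale_xsection (@lebesgue_measure R \x @lebesgue_measure R)%E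
  (m2 := @lebesgue_measure R) (normr_ge0 _) mcS) => -[x y].
pose e := x * c 0 0 + y * c 1 0 + d.
rewrite -[RHS](lebesgue_measure_affine e c0); last exact: measurable_xsection.
congr (lebesgue_measure _ * _)%E.
suff Exyz z : set_coord 2%:R c d (row3 (x, y, z)) = row3 (x, y, c 2%:R 0 * z + e).
  by apply/seteqP; split => z; rewrite !xsectionE /= Exyz.
apply/rowP => i; rewrite !mxE; elim/ord3_ind: i => //=.
by rewrite sum_ord3 !mxE /= /e; ring.
Qed.

Lemma set_coordE j c d v i :
  set_coord j c d v 0 i = if i == j then (v *m c) 0 0 + d else v 0 i.
Proof. by rewrite mxE. Qed.

(** Exchanging coordinate j with the last one reduces to the previous lemma. *)
Lemma rescales_set_coord (j : 'I_3) (c : 'cV[R]_3) (d : R) :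
  c j 0 != 0 -> rescales (set_coord j c d) `|c j 0|.
Proof.
move=> c0; pose t : 'S_3 := tperm j 2%:R; pose c' := row_perm t c.
have c'2 : c' 2%:R 0 = c j 0 by rewrite mxE tpermR.
have := rescales_comp (rescales_comp (rescales_col_perm t)
  (@rescales_set_coord_last c' d _)) (rescales_col_perm t).
rewrite c'2 mul1r mulr1 => /(_ c0); congr rescales; apply/funext => v /=.
apply/rowP => i; rewrite mxE !set_coordE mul_col_perm /c' -row_permM.
rewrite mulVg row_perm1 [col_perm t v 0 (t i)]mxE {2}/t tpermK.
by rewrite -(inj_eq (@perm_inj _ t) (t i)) /t tpermK tpermR.
Qed.

(** The new coordinate j depends on the old coordinates i >= j only, so the
coordinates can be updated in the order 0, 1, 2 (and 2, 1, 0 for an upper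
triangular matrix below). *)
Lemma rescales_lower (L : 'M[R]_3) :
  (forall i j : 'I_3, (i < j)%N -> L i j = 0) -> \det L != 0 ->
  rescales (mulmx^~ L) `|\det L|.
Proof.
move=> L0 detL.
have detE : \det L = L 0 0 * L 1 1 * L 2%:R 2%:R.
  rewrite det_trig; last by apply/is_trig_mxP.
  rewrite !big_ord_recr big_ord0 /= mul1r.
  by congr (L _ _ * L _ _ * L _ _); exact/val_inj.
move: detL; rewrite detE !mulf_eq0 !negb_or => /andP[/andP[L00 L11] L22].
have := rescales_comp (rescales_comp
  (@rescales_set_coord 0 (col 0 L) 0 _) (@rescales_set_coord 1 (col 1 L) 0 _))
  (@rescales_set_coord 2%:R (col 2%:R L) 0 _).
rewrite !mxE !normrM => /(_ L00 L11 L22); congr rescales; apply/funext => v /=.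
apply/rowP => i; elim/ord3_ind: i; rewrite !(set_coordE, mxE, sum_ord3) /=;
  rewrite ?(L0 0 1) ?(L0 0 2%:R) ?(L0 1 2%:R) //; ring.
Qed.

Lemma rescales_upper (U : 'M[R]_3) (b : 'rV[R]_3) :
  (forall i j : 'I_3, (j < i)%N -> U i j = 0) -> \det U != 0 ->
  rescales (fun v => v *m U + b) `|\det U|.
Proof.
move=> U0 detU.
have detE : \det U = U 2%:R 2%:R * U 1 1 * U 0 0.
  rewrite -det_tr det_trig; last first.
    by apply/is_trig_mxP => i j ij; rewrite mxE; exact: U0.
  rewrite !big_ord_recr big_ord0 /= mul1r !mxE.
  transitivity (U 0 0 * U 1 1 * U 2%:R 2%:R); last by ring.
  by congr (U _ _ * U _ _ * U _ _); exact/val_inj.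
move: detU; rewrite detE !mulf_eq0 !negb_or => /andP[/andP[U22 U11] U00].
have := rescales_comp (rescales_comp
  (@rescales_set_coord 2%:R (col 2%:R U) (b 0 2%:R) _)
  (@rescales_set_coord 1 (col 1 U) (b 0 1) _))
  (@rescales_set_coord 0 (col 0 U) (b 0 0) _).
rewrite !mxE !normrM => /(_ U22 U11 U00); congr rescales; apply/funext => v /=.
apply/rowP => i; elim/ord3_ind: i; rewrite !(set_coordE, mxE, sum_ord3) /=;
  rewrite ?(U0 1 0) ?(U0 2%:R 0) ?(U0 2%:R 1) //; ring.
Qed.

Lemma rescales_affine (M : 'M[R]_3) (b : 'rV[R]_3) :
  M \in unitmx -> rescales (fun v => v *m M + b) `|\det M|.
Proof.
move=> Mu; have [s [L [U [PM detL L0 U0]]]] := perm_LU M.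
have detU : `|\det U| = `|\det M|.
  have := congr1 determinant PM.
  rewrite !det_mulmx detL mul1r det_perm => <-.
  by rewrite normrM normr_sign mul1r.
have U_neq0 : \det U != 0.
  by rewrite -normr_eq0 detU normr_eq0 -unitfE -unitmxE.
have := rescales_comp (rescales_comp (rescales_col_perm s)
  (rescales_lower L0 _)) (rescales_upper b U0 U_neq0).
rewrite detL oner_neq0 normr1 !mul1r detU => /(_ isT).
congr rescales; apply/funext => v /=; congr (_ + b).
rewrite -mulmxA -PM col_permE.
by rewrite -mulmxA [_ *m (_ *m M)]mulmxA -perm_mxM mulVg perm_mx1 mul1mx.
Qed.

Lemma volume_le S U : S `<=` U -> (volume S <= volume U)%E.
Proof.
move=> SU; apply: (product_measure_le
    (@lebesgue_measure R \x @lebesgue_measure R)%E (m2 := @lebesgue_measure R)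
    (A := @row3 R @^-1` S) (B := @row3 R @^-1` U)) => p.
by apply: le_mu_ext => z; rewrite !xsectionE /=; exact: SU.
Qed.

Lemma volume_coord_last_eq (d : R) : volume [set v | v 0 2%:R = d] = 0%E.
Proof.
apply: integral0_eq => -[x y] _ /=.
rewrite (_ : xsection _ _ = [set d]) ?lebesgue_measure_set1 //.
by apply/seteqP; split => z; rewrite xsectionE /= mxE.
Qed.

(** Substituting the linear form v n for a coordinate on which it depends maps the
plane to one where a coordinate is constant; its sections over the two other
coordinates are points. *)
Lemma volume_hyperplane (n : 'cV[R]_3) (d : R) :
  n != 0 -> volume [set v | (v *m n) 0 0 = d] = 0%E.
Proof.
move=> n0; have [j nj] : exists j, n j 0 != 0.
  apply/existsP; apply: contraR n0; rewrite negb_exists => /forallP n0.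
  by apply/eqP/colP => j; rewrite mxE; have := n0 j; rewrite negbK => /eqP.
have mlast : measurable3 [set v | v 0 2%:R = d].
  have := measurable_row3_coord 2%:R measurableT (measurable_set1 d).
  by rewrite setTI.
have [_] := rescales_comp (rescales_set_coord 0 nj)
  (rescales_col_perm (tperm j 2%:R)) mlast.
rewrite volume_coord_last_eq mulr1 (_ : _ @^-1` _ = [set v | (v *m n) 0 0 = d]).
  by move=> /eqP; rewrite mule_eq0 eqe normr_eq0 (negPf nj) orbF => /eqP.
suff E v : col_perm (tperm j 2%:R) (set_coord j n 0 v) 0 2%:R = (v *m n) 0 0.
  by apply/seteqP; split => v /=; rewrite E.
by rewrite mxE tpermR set_coordE eqxx addr0.
Qed.

(** * Volumes of tetrahedra *)

Definition frame X Y Z W : 'M[R]_3 :=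
  \matrix_(i < 3) [:: Y - X; Z - X; W - X]`_i.

Lemma frame_affine (M : 'M[R]_3) (b : 'rV[R]_3) X Y Z W :
  frame (X *m M + b) (Y *m M + b) (Z *m M + b) (W *m M + b) =
  frame X Y Z W *m M.
Proof.
apply/row_matrixP => i; rewrite row_mul !rowK.
by elim/ord3_ind: i => /=; rewrite mulmxBl opprD addrACA subrr addr0.
Qed.

Lemma affine_comb (M : 'M[R]_3) (b X Y Z W : 'rV[R]_3) (p q r s : R) : p + q + r + s = 1 ->
  (p *: X + q *: Y + r *: Z + s *: W) *m M + b =
  p *: (X *m M + b) + q *: (Y *m M + b) + r *: (Z *m M + b) + s *: (W *m M + b).
Proof.
move=> pqrs; have -> : p = 1 - q - r - s by rewrite -pqrs; ring.
rewrite !mulmxDl -!scalemxAl; move: (X *m M) (Y *m M) (Z *m M) (W *m M) => x y z w.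
by apply/rowP => i; rewrite !mxE; ring.
Qed.

Lemma affine_inj (M : 'M[R]_3) (b : 'rV[R]_3) :
  M \in unitmx -> injective (fun v : 'rV[R]_3 => v *m M + b).
Proof. by move=> Mu v w /addIr; exact: (can_inj (mulmxK Mu)). Qed.

Lemma preimage_tetrahedron (M : 'M[R]_3) (b : 'rV[R]_3) X Y Z W : M \in unitmx ->
  (fun v => v *m M + b) @^-1` tetrahedron (X *m M + b) (Y *m M + b)
    (Z *m M + b) (W *m M + b) = tetrahedron X Y Z W.
Proof.
move=> Mu; apply/seteqP; split => v /= -[p [q [r [s [pos pqrs]]]]] E.
  by exists p, q, r, s; split => //; apply: (affine_inj Mu (b := b)); rewrite affine_comb.
by exists p, q, r, s; split => //; rewrite E affine_comb.
Qed.

Definition unit_tetrahedron : set 'rV[R]_3 :=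
  tetrahedron 0 (row 0 1%:M) (row 1 1%:M) (row 2%:R 1%:M).

Lemma unit_tetrahedronP v : unit_tetrahedron v <->
  [/\ 0 <= v 0 0, 0 <= v 0 1, 0 <= v 0 2%:R & v 0 0 + v 0 1 + v 0 2%:R <= 1].
Proof.
split.
  move=> [p [q [r [s [[p0 q0 r0 s0] pqrs ->]]]]].
  rewrite !mxE /=; split; nra.
move=> [v0 v1 v2 v012].
exists (1 - (v 0 0 + v 0 1 + v 0 2%:R)), (v 0 0), (v 0 1), (v 0 2%:R).
split; first by split => //; rewrite subr_ge0.
  by ring.
by apply/rowP; apply: ord3_ind; rewrite !mxE /=; ring.
Qed.

Lemma measurable3_unit_tetrahedron : measurable3 unit_tetrahedron.
Proof.
have mle (c : 'cV[R]_3) (d : R) : measurable3 [set v | 0 <= (v *m c) 0 0 + d].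
  have := measurable_row3_linear c d measurableT (measurable_itv `[0, +oo[).
  rewrite setTI; congr measurable.
  by apply/seteqP; split => p /=; rewrite in_itv /= andbT.
pose e i : 'cV[R]_3 := delta_mx i 0; pose neg1 : 'cV[R]_3 := const_mx (- 1).
have -> : unit_tetrahedron =
  [set v | 0 <= (v *m e 0) 0 0 + 0] `&`
  [set v | 0 <= (v *m e 1) 0 0 + 0] `&`
  [set v | 0 <= (v *m e 2%:R) 0 0 + 0] `&`
  [set v | 0 <= (v *m neg1) 0 0 + 1].
  apply/seteqP; split => v; rewrite /= -!colE !addr0 !mxE sum_ord3 !mxE.
    by move=> /unit_tetrahedronP[? ? ? ?]; do !split => //; lra.
  by move=> [[[? ?] ?] ?]; apply/unit_tetrahedronP; split => //; lra.
by do 3?apply: measurableI; exact: mle.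
Qed.

(** If the edge vectors at X are independent, the tetrahedron is the preimage of the
unit one under v |-> (v - X) F^-1, F being the frame.  Otherwise some n <> 0 has
F n = 0, and v n is constant on the tetrahedron. *)
Lemma volume_tetrahedron X Y Z W :
  volume (tetrahedron X Y Z W) =
  (`|\det (frame X Y Z W)|%:E * volume unit_tetrahedron)%E.
Proof.
have [detF|detF] := eqVneq (\det (frame X Y Z W)) 0.
  rewrite detF normr0 mul0e; apply/eqP; rewrite eq_le; apply/andP; split; last first.
    by rewrite /volume; apply: integral_ge0.
  have [n n0 nF] : exists2 n : 'cV[R]_3, n != 0 & frame X Y Z W *m n = 0.
    have /eqP/det0P[n n0 nF] : \det (frame X Y Z W)^T = 0 by rewrite det_tr.
    exists n^T; first by rewrite -(inj_eq trmx_inj) trmxK trmx0.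
    by rewrite -[frame _ _ _ _]trmxK -trmx_mul nF trmx0.
  rewrite -(volume_hyperplane ((X *m n) 0 0) n0); apply: volume_le => v /=.
  move=> [p [q [r [s [_ pqrs ->]]]]].
  have on U i : row i (frame X Y Z W) = U - X -> U *m n = X *m n.
    move=> rE; apply/eqP; rewrite -subr_eq0 -mulmxBl -rE -row_mul nF.
    by apply/eqP/rowP => k; rewrite !mxE.
  rewrite !mulmxDl -!scalemxAl (on Y 0) ?(on Z 1) ?(on W 2%:R) ?rowK //.
  by rewrite -!scalerDl pqrs scale1r.
pose M := frame X Y Z W; have Mu : M \in unitmx by rewrite unitmxE unitfE.
pose g v := v *m invmx M + - (X *m invmx M).
have gX : g X = 0 by rewrite /g subrr.
have gU U i : row i M = U - X -> g U = row i 1%:M.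
  by move=> rE; rewrite /g -mulmxBl -rE -row_mul mulmxV.
have Mu' : invmx M \in unitmx by rewrite unitmx_inv.
have gE : g @^-1` unit_tetrahedron = tetrahedron X Y Z W.
  rewrite -[RHS](preimage_tetrahedron (- (X *m invmx M)) _ _ _ _ Mu') -!/(g _).
  by rewrite gX (gU Y 0) ?(gU Z 1) ?(gU W 2%:R) ?rowK.
have [_] := rescales_affine (- (X *m invmx M)) Mu' measurable3_unit_tetrahedron.
rewrite -/g gE => <-; rewrite muleC -muleA -EFinM -normrM.
by rewrite -det_mulmx mulVmx// det1 normr1 mule1.
Qed.

End coordinates.

(** * Barycentric coordinates *)

Section barycentric.
Variable R : realType.
Implicit Types A B C D X Y Z W P Q S v : 'rV[R]_3.

Lemma eucl_dist_scale X Y Z W (s : R) : 0 <= s ->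
  (forall i, (X 0 i - Y 0 i) ^+ 2 = s ^+ 2 * (Z 0 i - W 0 i) ^+ 2) ->
  eucl_dist X Y = s * eucl_dist Z W.
Proof.
move=> s0 XY; rewrite /eucl_dist; under eq_bigr do rewrite XY.
by rewrite -mulr_sumr sqrtrM ?sqr_ge0// sqrtr_sqr ger0_norm.
Qed.

(** For P = (1 - t) X + t Y the distances to X and Y are t and 1 - t times |XY|, so
x = t / (1 - t).  The degenerate case |XY| = 0 is excluded because the quotient
would then be 0. *)
Lemma open_edge_ratio X Y P (x : R) : 0 < x -> open_edge X Y P ->
  eucl_dist P X / eucl_dist P Y = x -> P = (1 + x)^-1 *: (X + x *: Y).
Proof.
move=> x0 [t /andP[t0 t1] ->]; pose D := eucl_dist X Y.
have distX : eucl_dist ((1 - t) *: X + t *: Y) X = t * D.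
  by apply: eucl_dist_scale (ltW t0) _ => i; rewrite !mxE; ring.
have t1' : 0 < 1 - t by rewrite subr_gt0.
have distY : eucl_dist ((1 - t) *: X + t *: Y) Y = (1 - t) * D.
  by apply: eucl_dist_scale (ltW t1') _ => i; rewrite !mxE; ring.
rewrite distX distY => xE.
have D0 : D != 0.
  by apply: contraTneq x0 => D0; rewrite -xE D0 !mulr0 mul0r ltxx.
have {}xE : x = t / (1 - t) by rewrite -xE; field; rewrite D0 gt_eqF.
have x1E : (1 + x)^-1 = 1 - t.
  by rewrite xE; field; rewrite subrK oner_neq0 gt_eqF.
rewrite scalerDr scalerA x1E; congr (_ + _ *: _).
by rewrite xE; field; rewrite gt_eqF.
Qed.

Definition bary A B C D (a b c d : R) : 'rV[R]_3 :=
  a *: A + b *: B + c *: C + d *: D.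

(** Phrased through coordinates because this form is visibly invariant under a
cyclic shift of the points, whereas a frame singles out a base vertex. *)
Definition affine_basis A B C D : Prop :=
  (forall v, exists a b c d, a + b + c + d = 1 /\ v = bary A B C D a b c d) /\
  (forall a b c d a' b' c' d', a + b + c + d = 1 -> a' + b' + c' + d' = 1 ->
     bary A B C D a b c d = bary A B C D a' b' c' d' ->
     [/\ a = a', b = b', c = c' & d = d']).

Lemma bary_rot A B C D a b c d : bary A B C D a b c d = bary B C D A b c d a.
Proof. by rewrite /bary -!addrA addrC !addrA. Qed.

Lemma affine_basis_rot A B C D : affine_basis A B C D -> affine_basis B C D A.
Proof.
move=> [ex uniq]; split => [v|b c d a b' c' d' a' sum1 sum1'].
  have [a [b [c [d [sum1 ->]]]]] := ex v.
  by exists b, c, d, a; rewrite bary_rot; split => //; rewrite -sum1; ring.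
rewrite -[LHS]bary_rot -[RHS]bary_rot => /uniq[||-> -> -> ->] //.
  by rewrite -sum1; ring.
by rewrite -sum1'; ring.
Qed.

Lemma bary_frame A B C D (a b c d : R) : a + b + c + d = 1 ->
  bary A B C D a b c d = row3 (b, c, d) *m frame A B C D + A.
Proof.
move=> sum1; have -> : a = 1 - b - c - d by rewrite -sum1; ring.
by apply/rowP => i; rewrite !(mxE, sum_ord3) /=; ring.
Qed.

Lemma frame_affine_basis A B C D :
  frame A B C D \in unitmx -> affine_basis A B C D.
Proof.
move=> Fu; split => [v|a b c d a' b' c' d' sum1 sum1'].
  pose w := (v - A) *m invmx (frame A B C D).
  exists (1 - w 0 0 - w 0 1 - w 0 2%:R), (w 0 0), (w 0 1), (w 0 2%:R).
  split; first by ring.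
  rewrite bary_frame; last by ring.
  by rewrite (coordsK w) mulmxKV// subrK.
rewrite !bary_frame// => /(affine_inj Fu)/(can_inj (@row3K R))[bb cc dd].
by split => //; move: sum1 sum1'; rewrite bb cc dd => <- /esym; do 3!move/addIr.
Qed.

(** The plane contains A and B, so it is cut out by the ratio of the C- and
D-coordinates, which is read off at Q. *)
Lemma plane_bary A B C D Q (x a b c d : R) : affine_basis A B C D -> 0 < x ->
  Q = (1 + x)^-1 *: (C + x *: D) -> a + b + c + d = 1 ->
  plane A B Q (bary A B C D a b c d) <-> d = x * c.
Proof.
move=> [_ uniq] x0 -> sum1.
have x1 : 1 + x != 0 by rewrite gt_eqF// addr_gt0.
split.
  move=> [s [t E]].
  have [] := uniq _ _ _ _ (1 - s - t) s (t / (1 + x)) (t / (1 + x) * x) sum1.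
  - by field.
  - by rewrite E; apply/rowP => i; rewrite !mxE; field.
  - by move=> _ _ -> ->; rewrite mulrC.
move=> dE; exists b, (c + d); have -> : a = 1 - b - c - d by rewrite -sum1; ring.
by rewrite dE; apply/rowP => i; rewrite !mxE; field.
Qed.

(** The planes prescribe the ratios b : a = x, c : b = y and d : c = z; since the
coordinates sum to 1, they are determined. *)
Lemma three_planes A B C D P Q S (x y z : R) : affine_basis A B C D ->
  0 < x -> 0 < y -> 0 < z ->
  P = (1 + x)^-1 *: (A + x *: B) -> Q = (1 + y)^-1 *: (B + y *: C) ->
  S = (1 + z)^-1 *: (C + z *: D) ->
  let k := (1 + x + x * y + x * y * z)^-1 in
  plane C D P `&` plane D A Q `&` plane A B S =
    [set bary A B C D k (k * x) (k * (x * y)) (k * (x * y * z))].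
Proof.
move=> ABCD x0 y0 z0 PE QE SE k.
have BCDA := affine_basis_rot ABCD; have CDAB := affine_basis_rot BCDA.
have DABC := affine_basis_rot CDAB.
have k0 : 0 < 1 + x + x * y + x * y * z.
  by rewrite !addr_gt0// ?mulr_gt0// mulr_gt0.
have onP a b c d : a + b + c + d = 1 ->
    plane C D P (bary A B C D a b c d) <-> b = x * a.
  move=> sum1; rewrite bary_rot bary_rot; apply: plane_bary CDAB x0 PE _.
  by rewrite -sum1; ring.
have onQ a b c d : a + b + c + d = 1 ->
    plane D A Q (bary A B C D a b c d) <-> c = y * b.
  move=> sum1; rewrite bary_rot bary_rot bary_rot; apply: plane_bary DABC y0 QE _.
  by rewrite -sum1; ring.
have onS a b c d : a + b + c + d = 1 ->
    plane A B S (bary A B C D a b c d) <-> d = z * c.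
  by move=> sum1; apply: plane_bary ABCD z0 SE _.
apply/seteqP; split => [v|v ->].
  have [a [b [c [d [sum1 ->]]]]] := ABCD.1 v.
  move=> [[/onP-/(_ sum1) bE /onQ-/(_ sum1) cE] /onS-/(_ sum1) dE].
  have aE : a = k.
    have K0 : 1 + x + x * y + x * y * z != 0 by rewrite gt_eqF.
    apply: (mulIf K0); rewrite mulVf// -[RHS]sum1 dE cE bE; ring.
  by rewrite /= dE cE bE aE; congr bary; ring.
have sum1 : k + k * x + k * (x * y) + k * (x * y * z) = 1.
  by rewrite /k; field; rewrite gt_eqF.
split; first split.
- by apply/onP => //; ring.
- by apply/onQ => //; ring.
- by apply/onS => //; ring.
Qed.

Lemma volume_eq1_frame_unit A B C D :
  volume (tetrahedron A B C D) = 1%:E -> frame A B C D \in unitmx.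
Proof.
rewrite volume_tetrahedron unitmxE unitfE => vol1; apply/eqP => det0.
by move: vol1; rewrite det0 normr0 mul0e => /eqP; rewrite eqe eq_sym oner_eq0.
Qed.

(** The determinant is that of the coordinates with respect to B, C, D, relative to
the first vertex; the volume of the unit tetrahedron cancels against the
hypothesis on A B C D. *)
Lemma volume_bary A B C D (a1 b1 c1 d1 a2 b2 c2 d2 a3 b3 c3 d3 a4 b4 c4 d4 : R) :
  volume (tetrahedron A B C D) = 1%:E ->
  a1 + b1 + c1 + d1 = 1 -> a2 + b2 + c2 + d2 = 1 ->
  a3 + b3 + c3 + d3 = 1 -> a4 + b4 + c4 + d4 = 1 ->
  volume (tetrahedron (bary A B C D a1 b1 c1 d1) (bary A B C D a2 b2 c2 d2)
    (bary A B C D a3 b3 c3 d3) (bary A B C D a4 b4 c4 d4)) =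
  `|(b2 - b1) * ((c3 - c1) * (d4 - d1) - (d3 - d1) * (c4 - c1))
    - (c2 - c1) * ((b3 - b1) * (d4 - d1) - (d3 - d1) * (b4 - b1))
    + (d2 - d1) * ((b3 - b1) * (c4 - c1) - (c3 - c1) * (b4 - b1))|%:E.
Proof.
rewrite volume_tetrahedron => vol1 s1 s2 s3 s4; rewrite !bary_frame//.
rewrite volume_tetrahedron frame_affine det_mulmx normrM EFinM -muleA vol1 mule1.
by rewrite det_mx33 !mxE /=.
Qed.

End barycentric.

Theorem theorem4 (R : realType) (A1 A2 A3 A4 P1 P2 P3 P4 : 'rV[R]_3)
    (x1 x2 x3 x4 : R)
    (hA : volume (tetrahedron A1 A2 A3 A4) = 1%:E)
    (hx1 : 0 < x1) (hx2 : 0 < x2) (hx3 : 0 < x3) (hx4 : 0 < x4)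
    (hP1 : open_edge A1 A2 P1) (hP2 : open_edge A2 A3 P2)
    (hP3 : open_edge A3 A4 P3) (hP4 : open_edge A4 A1 P4)
    (hr1 : eucl_dist P1 A1 / eucl_dist P1 A2 = x1)
    (hr2 : eucl_dist P2 A2 / eucl_dist P2 A3 = x2)
    (hr3 : eucl_dist P3 A3 / eucl_dist P3 A4 = x3)
    (hr4 : eucl_dist P4 A4 / eucl_dist P4 A1 = x4) :
  volume (tetrahedron P1 P2 P3 P4) =
    (`|1 - x1 * x2 * x3 * x4| /
       ((1 + x1) * (1 + x2) * (1 + x3) * (1 + x4)))%:E
  /\
  exists R1 R2 R3 R4 : 'rV[R]_3,
    [/\ plane A2 A3 P4 `&` plane A3 A4 P1 `&` plane A4 A1 P2 = [set R1],
        plane A1 A2 P3 `&` plane A3 A4 P1 `&` plane A4 A1 P2 = [set R2],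
        plane A1 A2 P3 `&` plane A2 A3 P4 `&` plane A4 A1 P2 = [set R3],
        plane A1 A2 P3 `&` plane A2 A3 P4 `&` plane A3 A4 P1 = [set R4] &
        volume (tetrahedron R1 R2 R3 R4) =
          (`|1 - x1 * x2 * x3 * x4| ^+ 3 /
             ((1 + x1 + x1 * x2 + x1 * x2 * x3) *
              (1 + x2 + x2 * x3 + x2 * x3 * x4) *
              (1 + x3 + x3 * x4 + x3 * x4 * x1) *
              (1 + x4 + x4 * x1 + x4 * x1 * x2)))%:E].
Proof.
have Fu := volume_eq1_frame_unit hA.
have basis1 := frame_affine_basis Fu; have basis2 := affine_basis_rot basis1.
have basis3 := affine_basis_rot basis2; have basis4 := affine_basis_rot basis3.
have {hP1 hr1}P1E := open_edge_ratio hx1 hP1 hr1.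
have {hP2 hr2}P2E := open_edge_ratio hx2 hP2 hr2.
have {hP3 hr3}P3E := open_edge_ratio hx3 hP3 hr3.
have {hP4 hr4}P4E := open_edge_ratio hx4 hP4 hr4.
have S_gt0 (x : R) : 0 < x -> 0 < 1 + x by move=> x0; rewrite addr_gt0.
have D_gt0 (x y z : R) : 0 < x -> 0 < y -> 0 < z -> 0 < 1 + x + x * y + x * y * z.
  by move=> x0 y0 z0; rewrite !addr_gt0// !mulr_gt0.
have S1 := S_gt0 _ hx1; have S2 := S_gt0 _ hx2.
have S3 := S_gt0 _ hx3; have S4 := S_gt0 _ hx4.
have D1 := D_gt0 _ _ _ hx1 hx2 hx3; have D2 := D_gt0 _ _ _ hx2 hx3 hx4.
have D3 := D_gt0 _ _ _ hx3 hx4 hx1; have D4 := D_gt0 _ _ _ hx4 hx1 hx2.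
split.
  have P1b : P1 = bary A1 A2 A3 A4 (1 + x1)^-1 (x1 / (1 + x1)) 0 0.
    by rewrite P1E; apply/rowP => i; rewrite !mxE; ring.
  have P2b : P2 = bary A1 A2 A3 A4 0 (1 + x2)^-1 (x2 / (1 + x2)) 0.
    by rewrite P2E; apply/rowP => i; rewrite !mxE; ring.
  have P3b : P3 = bary A1 A2 A3 A4 0 0 (1 + x3)^-1 (x3 / (1 + x3)).
    by rewrite P3E; apply/rowP => i; rewrite !mxE; ring.
  have P4b : P4 = bary A1 A2 A3 A4 (x4 / (1 + x4)) 0 0 (1 + x4)^-1.
    by rewrite P4E; apply/rowP => i; rewrite !mxE; ring.
  rewrite P1b P2b P3b P4b volume_bary //; [|by field; rewrite gt_eqF..].
  congr EFin.
  rewrite -[X in _ = _ / X]gtr0_norm ?mulr_gt0// -normf_div; congr `|_|.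
  by field; rewrite !gt_eqF.
(* The rotations express all vertices in the coordinates given by A1, A2, A3, A4. *)
have := three_planes basis1 hx1 hx2 hx3 P1E P2E P3E.
have := three_planes basis2 hx2 hx3 hx4 P2E P3E P4E; rewrite /= 3!bary_rot.
have := three_planes basis3 hx3 hx4 hx1 P3E P4E P1E; rewrite /= 2!bary_rot.
have := three_planes basis4 hx4 hx1 hx2 P4E P1E P2E; rewrite /= bary_rot.
rewrite /= => I1 I4 I3 I2.
do 4!eexists; split.
- exact: I1.
- by rewrite -setIA setIC; exact: I2.
- by rewrite setIC setIA; exact: I3.
- exact: I4.
rewrite volume_bary //; [|by field; rewrite gt_eqF..].
congr EFin.
(* R1 is nearest to A4, R2 to A1 and so on when the ratios are small: this cyclic
   shift of the vertices is odd, which accounts for the sign. *)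
rewrite -[X in _ = _ / X]gtr0_norm ?mulr_gt0// -normrX -normf_div -normrN; congr `|_|.
by field; rewrite !gt_eqF.
Qed.
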